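(* Let $G$ be a discrete polycyclic group and let $T\in\mathrm{Aut}(G)$. Let $G_{\mathrm{nil}}$ be the unique maximal nilpotent normal subgroup of $G$. Then $\mathrm{Sub}^c_G$ is closed in $\mathrm{Sub}_G$. Consider the following statements: (1) $T\in\mathrm{(NC)}$. (2) There exist $n\in\mathbb{N}$ and a subgroup $G'$ of finite index in $G$ containing $G_{\mathrm{nil}}$ such that $T^n|_{G'}=\mathrm{Id}$, the identity map on $G'$, and $G'\cap G_x\neq\{e\}$ for every nontrivial element $x$ in $G$. (3) $T$ acts distally on $\mathrm{Sub}^c_G$. (4) $T$ acts distally on $\mathrm{Sub}^a_G$. (5) $T$ acts distally on $\mathrm{Sub}_G$. (6) $T^n=\mathrm{Id}$ for some $n\in\mathbb{N}$. Then (1) and (2) are equivalent, and (3), (4), (5) and (6) are equivalent. If $G$ is nilpotent, then (1)–(6) are all equivalent.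
   Context: A group $G$ is polycyclic if it admits a sequence of subgroups $G=G_0\supset G_1\supset\cdots\supset G_k=\{e\}$ such that each $G_{i+1}$ is normal in $G_i$ and $G_i/G_{i+1}$ is cyclic, $0\le i\le k-1$. Every polycyclic group has a unique maximal nilpotent normal subgroup. $\mathrm{Aut}(G)$ is the group of automorphisms of $G$; $e$ is the identity; $G_x$ is the cyclic subgroup generated by $x\in G$; $\mathbb{N}=\{1,2,\dots\}$. For a discrete group $G$, $\mathrm{Sub}_G$ is the set of all subgroups of $G$ with the Chabauty topology, which has as sub-basis the sets $\{A\in\mathrm{Sub}_G\mid A\cap K=\emptyset\}$ with $K\subset G$ finite and $\{A\in\mathrm{Sub}_G\mid A\cap U\ne\emptyset\}$ with $U\subset G$ arbitrary; it is compact Hausdorff. $\mathrm{Sub}^a_G$ (resp. $\mathrm{Sub}^c_G$) is the subspace of abelian (resp. cyclic) subgroups. Each $T\in\mathrm{Aut}(G)$ induces a homeomorphism $H\mapsto T(H)$ of $\mathrm{Sub}_G$, which preserves $\mathrm{Sub}^a_G$ and $\mathrm{Sub}^c_G$. A homeomorphism $S$ of a Hausdorff space $X$ is distal if for all $x\neq y$ in $X$ the closure of $\{(S^n(x),S^n(y))\mid n\in\mathbb{Z}\}$ in $X\times X$ does not meet the diagonal. $T$ acts distally on $\mathrm{Sub}_G$ (resp. $\mathrm{Sub}^a_G$, $\mathrm{Sub}^c_G$) if the homeomorphism $H\mapsto T(H)$ of that space is distal. $T\in\mathrm{(NC)}$ means: for every nontrivial cyclic subgroup $A$ of $G$ and every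 sequence $\{n_k\}\subset\mathbb{Z}$, $T^{n_k}(A)\not\to\{e\}$ in $\mathrm{Sub}_G$. *)

(* Defs.v *)
From HB Require Import structures.
From mathcomp Require Import all_boot all_order all_algebra.
From mathcomp Require Import finmap all_classical topology.

Set Implicit Arguments.
Unset Strict Implicit.
Unset Printing Implicit Defensive.

Local Open Scope classical_set_scope.
Local Open Scope group_scope.

Record is_subgroup (G : groupType) (A : set G) : Prop := IsSubgroup {
  is_subgroup1 : A 1;
  is_subgroupM : forall x y, A x -> A y -> A (x * y);
  is_subgroupV : forall x, A x -> A x^-1 }.

Record subgroup (G : groupType) := Subgroup {
  subgroup_set :> set G;
  subgroupP : is_subgroup subgroup_set }.

HB.instance Definition _ (G : groupType) := gen_eqMixin (subgroup G).
HB.instance Definition _ (G : groupType) := gen_choiceMixin (subgroup G).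

Lemma subgroup_inj (G : groupType) (A B : subgroup G) :
  A = B :> set G -> A = B.
Proof.
case: A B => [A pA] [B pB] /= eAB; move: pB; rewrite -eAB => pB.
by congr Subgroup; exact: Prop_irrelevance.
Qed.

Fact is_subgroup_one (G : groupType) : is_subgroup [set 1 : G].
Proof.
by split=> // [x y /= -> ->|x /= ->]; rewrite ?mulg1 ?invg1.
Qed.

Definition one_subgroup (G : groupType) := Subgroup (is_subgroup_one G).

Fact is_subgroup_full (G : groupType) : is_subgroup [set: G].
Proof. by split. Qed.

Definition full_subgroup (G : groupType) := Subgroup (is_subgroup_full G).

Fact is_subgroup_gen (G : groupType) (X : set G) :
  is_subgroup (smallest (@is_subgroup G) X).
Proof.
split=> [A [sA _]|x y Xx Xy A [sA XA]|x Xx A [sA XA]].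
- exact: is_subgroup1.
- by apply: is_subgroupM => //; [apply: Xx|apply: Xy].
- by apply: is_subgroupV => //; apply: Xx.
Qed.

Definition gen_subgroup (G : groupType) (X : set G) :=
  Subgroup (is_subgroup_gen X).

Definition cycle_subgroup (G : groupType) (x : G) := gen_subgroup [set x].

Definition cyclic_subgroups (G : groupType) : set (subgroup G) :=
  [set A : subgroup G | exists x, A = cycle_subgroup x].

Definition abelian_subgroups (G : groupType) : set (subgroup G) :=
  [set A : subgroup G | forall x y,
    subgroup_set A x -> subgroup_set A y -> commute x y].

Definition left_coset (G : groupType) (x : G) (N : set G) : set G :=
  [set x * y | y in N].

Definition normal_in (G : groupType) (N H : subgroup G) : Prop :=
  N `<=` H /\
  forall x y, subgroup_set H x -> subgroup_set N y -> subgroup_set N (y ^ x).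

Definition zexpg (G : groupType) (x : G) (n : int) : G :=
  match n with Posz m => x ^+ m | Negz m => x ^- m.+1 end.

(* The quotient group H / N is cyclic, for N normal in H: some coset gN
   generates it, where (gN)^n = g^n N in the quotient. *)
Definition cyclic_quotient (G : groupType) (H N : subgroup G) : Prop :=
  exists2 g, subgroup_set H g &
    forall x, subgroup_set H x ->
      exists n : int, left_coset x N = left_coset (zexpg g n) N.

Definition polycyclic (G : groupType) : Prop :=
  exists (k : nat) (H : nat -> subgroup G),
    [/\ H 0%N = full_subgroup G, H k = one_subgroup G &
        forall i, (i < k)%N ->
          normal_in (H i.+1) (H i) /\ cyclic_quotient (H i) (H i.+1)].

Fixpoint lower_central (G : groupType) (H : subgroup G) (n : nat) :
    subgroup G :=
  if n is m.+1 then
    gen_subgroup [set z | exists x y,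
      [/\ subgroup_set (lower_central H m) x, subgroup_set H y & z = [~ x, y]]]
  else H.

Definition nilpotent_subgroup (G : groupType) (H : subgroup G) : Prop :=
  exists n, lower_central H n = one_subgroup G.

Definition maximal_nilpotent_normal (G : groupType) (N : subgroup G) : Prop :=
  [/\ normal_in N (full_subgroup G), nilpotent_subgroup N &
      forall M : subgroup G, normal_in M (full_subgroup G) ->
        nilpotent_subgroup M -> N `<=` M -> M = N].

Definition finite_index (G : groupType) (H : subgroup G) : Prop :=
  finite_set [set left_coset x H | x in [set: G]].

Record automorphism (G : groupType) := Automorphism {
  aut_fun :> G -> G;
  aut_inv : G -> G;
  aut_funM : {morph aut_fun : x y / x * y};
  aut_funK : cancel aut_fun aut_inv;
  aut_invK : cancel aut_inv aut_fun }.

Lemma aut_invM (G : groupType) (T : automorphism G) :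
  {morph aut_inv T : x y / x * y}.
Proof.
move=> x y; apply: (can_inj (@aut_funK _ T)).
by rewrite aut_funM !aut_invK.
Qed.

Definition aut_inverse (G : groupType) (T : automorphism G) : automorphism G :=
  Automorphism (@aut_invM _ T) (@aut_invK _ T) (@aut_funK _ T).

(* Chabauty topology of a discrete group: the compact subsets K are the finite
   ones and every subset U is open. *)
Definition chabauty_subbasis (G : groupType) : set (set (subgroup G)) :=
  [set [set A : subgroup G | A `&` K = set0] |
     K in [set K : set G | finite_set K]] `|`
  [set [set A : subgroup G | A `&` U !=set0] | U in [set: set G]].

HB.instance Definition _ (G : groupType) :=
  isSubBaseTopological.Build (subgroup G) (@chabauty_subbasis G) id.

Lemma chabauty_subbasis_open (G : groupType) (V : set (subgroup G)) :
  chabauty_subbasis V -> open V.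
Proof.
move=> cV; exists [set V]; last by rewrite bigcup_set1.
move=> _ ->; exists [fset V]%fset; first by move=> W /fset1P ->; apply/mem_set.
by rewrite set_fset1 bigcap_set1.
Qed.

Lemma chabauty_continuous (X : topologicalType) (G : groupType)
    (f : X -> subgroup G) :
  (forall V, chabauty_subbasis V -> open (f @^-1` V)) -> continuous f.
Proof.
move=> fV; apply/continuousP => _ [D' D'sub <-].
rewrite preimage_bigcup; apply: bigcup_open => i /D'sub [F sF <-].
rewrite preimage_bigcap; rewrite bigcap_fset big_seq.
elim/big_ind: _ => [|U V oU oV|j jF]; [exact: openT|exact: openI|].
by apply: fV; have := sF _ jF; rewrite inE.
Qed.

Record homeomorphism (X : topologicalType) := Homeomorphism {
  homeo_fun :> X -> X;
  homeo_inv : X -> X;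
  homeo_funK : cancel homeo_fun homeo_inv;
  homeo_invK : cancel homeo_inv homeo_fun;
  homeo_fun_continuous : continuous homeo_fun;
  homeo_inv_continuous : continuous homeo_inv }.

Definition homeo_iter (X : topologicalType) (S : homeomorphism X) (n : int) :
    X -> X :=
  match n with Posz m => iter m S | Negz m => iter m.+1 (homeo_inv S) end.

Definition distal (X : topologicalType) (S : homeomorphism X) : Prop :=
  forall x y : X, x <> y ->
    closure [set (homeo_iter S n x, homeo_iter S n y) | n in [set: int]]
      `&` [set p : X * X | p.1 = p.2] = set0.

Section RestrictHomeo.
Context (X : topologicalType) (S : homeomorphism X) (A : set X).
Context (SA : forall x, A x -> A (S x)).
Context (SVA : forall x, A x -> A (homeo_inv S x)).

Definition restrict_fun (f : X -> X) (fA : forall x, A x -> A (f x)) (a : A) :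
    A :=
  exist _ (f (\val a)) (mem_set (fA _ (set_mem (valP a)))).

Fact restrict_fun_continuous (f : X -> X) (fA : forall x, A x -> A (f x)) :
  continuous f -> continuous (restrict_fun fA).
Proof.
move=> cf; apply: continuous_comp_initial => a.
apply: (@continuous_comp A X X (\val) f); last exact: cf.
exact: (@initial_continuous A X set_val).
Qed.

Fact restrict_funK : cancel (restrict_fun SA) (restrict_fun SVA).
Proof. by move=> a; apply: val_inj; rewrite /= homeo_funK. Qed.

Fact restrict_invK : cancel (restrict_fun SVA) (restrict_fun SA).
Proof. by move=> a; apply: val_inj; rewrite /= homeo_invK. Qed.

Definition restrict_homeo : homeomorphism A :=
  Homeomorphism restrict_funK restrict_invK
    (@restrict_fun_continuous _ SA (@homeo_fun_continuous _ S))
    (@restrict_fun_continuous _ SVA (@homeo_inv_continuous _ S)).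

End RestrictHomeo.

Section SubgroupAction.
Context (G : groupType).
Implicit Type T : automorphism G.

Lemma aut_fun1 T : T 1 = 1.
Proof. by apply: (@mulgI _ (T 1)); rewrite -aut_funM !mulg1. Qed.

Lemma aut_funV T x : T x^-1 = (T x)^-1.
Proof. by apply: (@mulgI _ (T x)); rewrite -aut_funM !mulgV aut_fun1. Qed.

Fact is_subgroup_image T (A : subgroup G) : is_subgroup (T @` A).
Proof.
have [A1 AM AV] := subgroupP A; split.
- by exists 1; rewrite ?aut_fun1.
- move=> _ _ [x Ax <-] [y Ay <-].
  by exists (x * y); [exact: AM|rewrite aut_funM].
- by move=> _ [x Ax <-]; exists x^-1; [exact: AV|rewrite aut_funV].
Qed.

Definition subgroup_image T (A : subgroup G) : subgroup G :=
  Subgroup (is_subgroup_image T A).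

Fact subgroup_imageK T :
  cancel (subgroup_image T) (subgroup_image (aut_inverse T)).
Proof.
move=> A; apply: subgroup_inj; rewrite /= image_comp.
rewrite (_ : aut_inv T \o T = id) ?image_id //.
by apply/funext => x /=; rewrite aut_funK.
Qed.

Fact subgroup_invK T :
  cancel (subgroup_image (aut_inverse T)) (subgroup_image T).
Proof.
move=> A; apply: subgroup_inj; rewrite /= image_comp.
rewrite (_ : T \o aut_inv T = id) ?image_id //.
by apply/funext => x /=; rewrite aut_invK.
Qed.

Fact subgroup_image_continuous T : continuous (subgroup_image T).
Proof.
have subI (U : set G) (A : subgroup G) :
    (subgroup_image T A `&` U !=set0) <-> (A `&` T @^-1` U !=set0).
  split=> [[_ [[x Ax <-] Ux]]|[x [Ax Ux]]]; first by exists x.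
  by exists (T x); split=> //; exists x.
apply: chabauty_continuous => _ [[K fK <-]|[U _ <-]];
  apply: chabauty_subbasis_open.
- left; exists (T @^-1` K).
    rewrite (_ : T @^-1` K = aut_inv T @` K); first exact: finite_image.
    apply/seteqP; split=> [x Kx|_ [y Ky <-]]; last by rewrite /= aut_invK.
    by exists (T x); rewrite ?aut_funK.
  apply/seteqP; split=> A /= A0; apply: contrapT => /eqP/set0P.
    by move=> /subI/set0P; rewrite A0 eqxx.
  by move=> /subI/set0P; rewrite A0 eqxx.
- by right; exists (T @^-1` U) => //; apply/seteqP; split=> A /subI.
Qed.

Definition subgroup_homeo T : homeomorphism (subgroup G) :=
  Homeomorphism (@subgroup_imageK T) (@subgroup_invK T)
    (@subgroup_image_continuous T)
    (@subgroup_image_continuous (aut_inverse T)).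

Fact cyclic_image T A :
  @cyclic_subgroups G A -> cyclic_subgroups (subgroup_image T A).
Proof.
move=> [x ->]; exists (T x); apply: subgroup_inj; apply/seteqP; split.
  move=> _ [y /= xy <-] B [sB xB].
  have sTB : is_subgroup (T @^-1` B).
    have [B1 BM BV] := sB; split=> [|u v Bu Bv|u Bu]; rewrite /preimage/=.
    - by rewrite aut_fun1.
    - by rewrite aut_funM; apply: BM.
    - by rewrite aut_funV; apply: BV.
  by apply: (xy (T @^-1` B)); split=> // _ ->; apply: xB.
apply: smallest_sub; first exact: is_subgroup_image.
by move=> _ ->; exists x => //; apply: sub_gen_smallest.
Qed.

Fact abelian_image T A :
  @abelian_subgroups G A -> abelian_subgroups (subgroup_image T A).
Proof.
move=> cA _ _ [x Ax <-] [y Ay <-].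
by rewrite /commute -!aut_funM cA.
Qed.

Definition cyclic_homeo T : homeomorphism (@cyclic_subgroups G) :=
  restrict_homeo (S := subgroup_homeo T) (@cyclic_image T)
    (@cyclic_image (aut_inverse T)).

Definition abelian_homeo T : homeomorphism (@abelian_subgroups G) :=
  restrict_homeo (S := subgroup_homeo T) (@abelian_image T)
    (@abelian_image (aut_inverse T)).

(* [homeo_iter (subgroup_homeo T) n A] is the image subgroup T^n(A). *)
Definition NC T : Prop :=
  forall A : subgroup G, cyclic_subgroups A -> A <> one_subgroup G ->
  forall n : nat -> int,
    ~ ((fun k => homeo_iter (subgroup_homeo T) (n k) A) @ \oo
         --> one_subgroup G).

End SubgroupAction.

(* Main.v *)
Require Import Defs.
From mathcomp Require Import all_boot all_order all_algebra.
From mathcomp Require Import finmap all_classical topology.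

(** Let [P] be the set of [T]-periodic elements of [G]. Every subgroup of a
    polycyclic group is finitely generated, so [P] is the fixed subgroup of a
    single power [T ^ n] ([periodic_uniform]). Finite generation also gives the
    closedness of the cyclic subgroups: a subgroup [A] close to a cyclic one on
    a generating set of [A] is contained in it, hence cyclic.

    The dynamics rests on an escape phenomenon ([cycle_escape]): given [g] and a
    finite set [K], for large [k] the map [T ^ k] sends no non-periodic element
    of the cyclic group of [g] into [K]. Indeed [G] carries a height [l] with
    values in the natural numbers, such that [l (x ^ n) = |n| l x], and which
    vanishes on torsion elements only ([polycyclic_height]). If [g] is not
    torsion then [l (T ^ k g) >= 1], so that [T ^ k (g ^ m)] can be in [K] only
    when [|m|] is at most the maximum of [l] on [K]; thus only finitely many
    elements of the cyclic group ever visit [K], and a non-periodic one visits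
    [K] finitely often.

    - Escape shows that [T ^ k (<x>)] tends to the trivial subgroup when [<x>]
      meets [P] trivially. Hence (NC) holds if and only if [P] meets every
      nontrivial cyclic subgroup. In that case every element of [G] has a
      positive power in [P], and in a polycyclic group this forces [P] to have
      finite index ([power_dense_finite_index]).
    - Escape also shows that [T ^ (n k) (<x>)] accumulates at [<x> /\ P], on
      which [T ^ n] is the identity; distality on cyclic subgroups therefore
      gives [<x> = <x> /\ P] for all [x], i.e., [T ^ n] is the identity.
      Conversely, if [T ^ n] is the identity then the orbit of an element that
      distinguishes two subgroups is finite, and it keeps their images apart.
    - There remains to see that, under (NC), a nilpotent normal subgroup [N] is
      contained in [P] ([nilpotent_normal_periodic]). Let [C] be the normal core
      of [P] and let [g] be in [N]. As [C] has finite index, some power [R] of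
      [T ^ n] satisfies [R g = g c] with [c] in [C]; since [R] is the identity
      on [C], the element [c] is central in [C]. Some [g ^ m] is in [C], so
      [(g c) ^ m = R (g ^ m) = g ^ m], which says that the product of the
      conjugates of [c] by [1, g, ..., g ^ (m - 1)] is trivial. Now [g] acts on
      the center of [C] with finite order, and unipotently because [N] is
      nilpotent and normal; this makes [c] torsion ([norm1_unipotent_torsion]),
      and [R ^ k g = g c ^ k] returns to [g]. *)

Set Implicit Arguments.
Unset Strict Implicit.
Unset Printing Implicit Defensive.

Local Open Scope classical_set_scope.
Local Open Scope group_scope.

(** * Integer powers and cyclic subgroups *)

Section IntegerPowers.
Context (G : groupType).
Implicit Types (x y : G) (m n : int).

Lemma zexpgS x n : zexpg x (n + 1)%R = zexpg x n * x.
Proof.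
case: n => [n|[|n]]; first by rewrite GRing.addrC -intS /= expgSr.
- by rewrite /= mulVg.
- have -> : (Negz n.+1 + 1 = Negz n)%R.
    by rewrite !NegzE intS GRing.opprD GRing.addrC GRing.addNKr.
  by rewrite /= [x ^+ n.+2]expgS invgM mulgVK.
Qed.

Lemma zexpgB1 x n : zexpg x (n - 1)%R = zexpg x n * x^-1.
Proof. by rewrite -[in RHS](GRing.subrK 1%R n) zexpgS mulgK. Qed.

Lemma zexpgD x m n : zexpg x (m + n)%R = zexpg x m * zexpg x n.
Proof.
elim/int_rect: n => [|n IHn|n IHn]; first by rewrite GRing.addr0 mulg1.
- by rewrite intS (GRing.addrC 1%R) GRing.addrA !zexpgS IHn mulgA.
- by rewrite intS (GRing.addrC 1%R) GRing.opprD GRing.addrA !zexpgB1 IHn mulgA.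
Qed.

Lemma zexpgN x n : zexpg x (- n)%R = (zexpg x n)^-1.
Proof.
by apply: (@mulIg _ (zexpg x n)); rewrite -zexpgD GRing.addNr mulVg.
Qed.

Lemma zexpgM x m n : zexpg x (m * n)%R = zexpg (zexpg x m) n.
Proof.
elim/int_rect: n => [|n IHn|n IHn]; first by rewrite GRing.mulr0.
- by rewrite intS (GRing.addrC 1%R) zexpgS -IHn -zexpgD GRing.mulrDr GRing.mulr1.
- rewrite intS (GRing.addrC 1%R) GRing.opprD zexpgB1 -IHn -zexpgN -zexpgD.
  by rewrite GRing.mulrBr GRing.mulr1.
Qed.

Lemma subgroup_zexpg (A : subgroup G) x n :
  subgroup_set A x -> subgroup_set A (zexpg x n).
Proof.
have [A1 AM AV] := subgroupP A => Ax.
have AX k : subgroup_set A (x ^+ k).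
  by elim: k => // k IHk; rewrite expgS; apply: AM.
by case: n => k /=; [apply: AX|apply: AV; apply: AX].
Qed.

Fact is_subgroup_zexpg x : is_subgroup [set zexpg x n | n in [set: int]].
Proof.
split=> [|_ _ [m _ <-] [n _ <-]|_ [n _ <-]]; first by exists 0%R.
- by exists (m + n)%R; rewrite ?zexpgD.
- by exists (- n)%R; rewrite ?zexpgN.
Qed.

Lemma cycle_subgroupP x y :
  subgroup_set (cycle_subgroup x) y <-> exists n, y = zexpg x n.
Proof.
split=> [xy|[n ->] A [sA xA]].
  have [|n _ <-] := xy [set zexpg x n | n in [set: int]]; last by exists n.
  by split=> [|_ ->]; [apply: is_subgroup_zexpg|exists 1%R].
by apply: (@subgroup_zexpg (Subgroup sA)); apply: xA.
Qed.

Lemma cycle_subgroup_id x : subgroup_set (cycle_subgroup x) x.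
Proof. by apply/cycle_subgroupP; exists 1%R. Qed.

Lemma cycle_subgroup_sub x (A : subgroup G) :
  subgroup_set A x -> cycle_subgroup x `<=` A.
Proof. by move=> Ax y /cycle_subgroupP[n ->]; apply: subgroup_zexpg. Qed.

End IntegerPowers.

Arguments cycle_subgroup_id [G] x [_] _.

Lemma aut_funX (G : groupType) (T : automorphism G) x k :
  T (x ^+ k) = T x ^+ k.
Proof.
by elim: k => [|k IHk]; rewrite ?aut_fun1 // !expgS aut_funM IHk.
Qed.

Lemma subgroup_ext (G : groupType) (A B : subgroup G) :
  (forall x, subgroup_set A x <-> subgroup_set B x) -> A = B.
Proof. by move=> AB; apply: subgroup_inj; apply/seteqP; split=> x /AB. Qed.

Section IntersectSubgroups.
Context (G : groupType) (A B : subgroup G).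

Fact is_subgroup_setI : is_subgroup (A `&` B).
Proof.
have [[A1 AM AV] [B1 BM BV]] := (subgroupP A, subgroupP B).
split=> [|x y [Ax Bx] [Ay By]|x [Ax Bx]]; first by split.
- by split; [apply: AM|apply: BM].
- by split; [apply: AV|apply: BV].
Qed.

Definition setI_subgroup := Subgroup is_subgroup_setI.

End IntersectSubgroups.

(** * Cyclic quotients *)

Lemma int_divn (n : int) (d : nat) : (0 < d)%N ->
  exists q, exists2 r : nat, (r < d)%N & n = (Posz d * q + Posz r)%R.
Proof.
move=> d_gt0; exists (n %/ Posz d)%Z.
have := modz_ge0 n (lt0n_neq0 d_gt0 : Posz d != 0%R).
have := ltz_pmod n (d_gt0 : (0 < Posz d)%R).
case E: (n %% Posz d)%Z => [r|//] lt_rd _; exists r => //.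
by rewrite [LHS](divz_eq n (Posz d)) GRing.mulrC E.
Qed.

Lemma int_subgroup_principal (Q : int -> Prop) :
    Q 0%R -> (forall m n, Q m -> Q n -> Q (m - n)%R) ->
  exists2 d, Q d & forall n, Q n -> exists q, n = (d * q)%R.
Proof.
move=> Q0 QB.
have QN n : Q n -> Q (- n)%R by move=> Qn; rewrite -GRing.sub0r; apply: QB.
have QD m n : Q m -> Q n -> Q (m + n)%R.
  by move=> Qm /QN/(QB _ _ Qm); rewrite GRing.opprK.
have [[n Qn nN0]|Qonly0] := pselect (exists2 n, Q n & n <> 0%R); last first.
  exists 0%R => // n Qn; exists 0%R; rewrite GRing.mul0r.
  by apply: contrapT => nN0; apply: Qonly0; exists n.
pose posQ := [pred k : nat | (0 < k)%N && `[< Q k >]].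
have /ex_minnP[d /andP[d_gt0 /asboolP Qd] d_min] : exists k, posQ k.
  exists `|n|%N; rewrite /= absz_gt0; apply/andP; split; first by apply/eqP.
  by apply/asboolP; rewrite abszE; case: (Num.Theory.ler0P n) => _ //; apply: QN.
have QM q : Q (Posz d * q)%R.
  elim/int_rect: q => [|q IHq|q IHq]; first by rewrite GRing.mulr0.
  - by rewrite intS (GRing.addrC 1%R) GRing.mulrDr GRing.mulr1; apply: QD.
  - by rewrite intS (GRing.addrC 1%R) GRing.opprD GRing.mulrBr GRing.mulr1; apply: QB.
exists (Posz d) => // k Qk; have [q [r lt_rd Ek]] := int_divn k d_gt0.
exists q; rewrite Ek; case: r lt_rd Ek => [|r] lt_rd Ek.
  by rewrite GRing.addr0.
have Qr : Q (Posz r.+1).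
  by rewrite -(GRing.addKr (Posz d * q)%R r.+1) -Ek GRing.addrC; apply: QB.
by have := d_min r.+1; rewrite /= leqNgt lt_rd => /(_ (asboolT Qr)).
Qed.

(** For [N] normal in [H], this says that the image of [g] generates [H / N]. It
    is also meaningful when [H] does not contain [N], a case that arises when [H]
    is replaced by one of its subgroups. *)
Definition cyclic_over (G : groupType) (H N : set G) (g : G) : Prop :=
  forall x, H x -> exists n : int, N ((zexpg g n)^-1 * x).

Section CyclicQuotients.
Context (G : groupType) (H N : subgroup G) (nNH : normal_in N H).
Implicit Types (g x y : G).

Let HM := is_subgroupM (subgroupP H).
Let HV := is_subgroupV (subgroupP H).
Let N1 := is_subgroup1 (subgroupP N).
Let NM := is_subgroupM (subgroupP N).
Let NV := is_subgroupV (subgroupP N).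
Let NJ : forall x y, subgroup_set H x -> subgroup_set N y -> subgroup_set N (y ^ x).
Proof. by case: nNH. Qed.

Lemma cyclic_over_of_quotient :
  cyclic_quotient H N -> exists2 g, subgroup_set H g & cyclic_over H N g.
Proof.
move=> [g Hg gen_g]; exists g => // x /gen_g[n eq_xN]; exists n.
have [y Ny <-] : left_coset (zexpg g n) N x.
  by rewrite -eq_xN; exists 1; rewrite ?mulg1.
by rewrite mulKg.
Qed.

Lemma coset_trans y x z : subgroup_set N (x^-1 * y) ->
  subgroup_set N (y^-1 * z) -> subgroup_set N (x^-1 * z).
Proof. by move=> /NM xy /xy; rewrite mulgA mulgK. Qed.

Lemma coset_sym x y : subgroup_set N (x^-1 * y) -> subgroup_set N (y^-1 * x).
Proof. by move=> /NV; rewrite invgM invgK. Qed.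

Lemma coset_mul x x' y y' : subgroup_set H y -> subgroup_set N (x^-1 * x') ->
  subgroup_set N (y^-1 * y') -> subgroup_set N ((x * y)^-1 * (x' * y')).
Proof.
move=> Hy /(NJ Hy) xx' /(NM xx'); congr (subgroup_set N _).
by rewrite conjgE invgM !mulgA mulgK.
Qed.

Lemma coset_inv x y : subgroup_set H x -> subgroup_set N (x^-1 * y) ->
  subgroup_set N ((x^-1)^-1 * y^-1).
Proof.
move=> /HV Hx /(NJ Hx)/NV; congr (subgroup_set N _).
by rewrite conjgE mulgA mulKg invgM.
Qed.

Lemma coset_zexpg x y n : subgroup_set H x -> subgroup_set N (x^-1 * y) ->
  subgroup_set N ((zexpg x n)^-1 * zexpg y n).
Proof.
move=> Hx xy.
have cosetX k : subgroup_set N ((x ^+ k)^-1 * y ^+ k).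
  elim: k => [|k IHk]; first by rewrite mulVg.
  by rewrite !expgSr; apply: coset_mul.
case: n => k /=; first exact: cosetX.
by apply: coset_inv; [apply: (subgroup_zexpg k.+1)|apply: cosetX].
Qed.

(** The exponents [n] for which [A] meets [g ^ n N] form a subgroup of the
    integers, and an element of [A] realizing a generator of it generates
    [A] modulo [N]. *)
Lemma cyclic_over_subgroup g (A : subgroup G) : A `<=` H ->
    subgroup_set H g -> cyclic_over H N g ->
  exists2 a, subgroup_set A a & cyclic_over A N a.
Proof.
move=> sAH Hg gen_g; have [A1 AM AV] := subgroupP A.
pose Q n := exists2 a, subgroup_set A a & subgroup_set N ((zexpg g n)^-1 * a).
have HX n : subgroup_set H (zexpg g n) by apply: subgroup_zexpg.
have [|m n [a Aa ga] [b Ab gb]|d [a Aa ga] Qdvd] := @int_subgroup_principal Q.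
- by exists 1 => //; rewrite mulg1 invg1.
- exists (a / b); first by apply: AM => //; apply: AV.
  rewrite zexpgD zexpgN; apply: coset_mul => //; first exact: HV.
  exact: coset_inv.
exists a => // x Ax; have [n gx] := gen_g x (sAH _ Ax).
have [|q En] := Qdvd n; first by exists x.
exists q; apply: coset_trans gx; apply: coset_sym; rewrite En zexpgM.
exact: coset_zexpg.
Qed.

End CyclicQuotients.

(** Induction climbs the polycyclic series from the trivial subgroup up to [G];
    each step is an extension [N <= H] with [H / N] generated by one element. *)
Lemma polycyclic_ind (G : groupType) (P : subgroup G -> Prop) :
    P (one_subgroup G) ->
    (forall H N g, normal_in N H -> subgroup_set H g -> cyclic_over H N g ->
       P N -> P H) ->
  polycyclic G -> P (full_subgroup G).
Proof.
move=> P1 Pext [k [H [H0 Hk Hext]]]; rewrite -H0 -(subnn k).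
have : (k <= k)%N by []; elim: {1 4}k => [|i IHi] lt_ik; first by rewrite subn0 Hk.
have [|nH /cyclic_over_of_quotient[g Hg gen_g]] := Hext (k - i.+1)%N.
  by rewrite subnSK // leq_subr.
by apply: Pext nH Hg gen_g _; rewrite subnSK //; apply: IHi; apply: ltnW.
Qed.

Lemma normal_one (G : groupType) (H : subgroup G) :
  normal_in (one_subgroup G) H.
Proof.
split=> [_ ->|x _ _ ->]; last by rewrite /= conj1g.
exact: (is_subgroup1 (subgroupP H)).
Qed.

(** This is [cyclic_over_subgroup] for the trivial normal subgroup. *)
Lemma cyclic_subgroup_cyclic (G : groupType) (A B : subgroup G) :
  cyclic_subgroups B -> A `<=` B -> cyclic_subgroups A.
Proof.
move=> [x ->] sAB.
have gen_x : cyclic_over (cycle_subgroup x) (one_subgroup G) x.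
  by move=> _ /cycle_subgroupP[n ->]; exists n; rewrite /= mulVg.
have [a Aa gen_a] :=
  cyclic_over_subgroup (normal_one (cycle_subgroup x)) sAB (cycle_subgroup_id x) gen_x.
exists a; apply: subgroup_ext => y; split=> [Ay|]; last exact: cycle_subgroup_sub.
by have [n /mulg1_eq] := gen_a y Ay; rewrite invgK => <-; apply/cycle_subgroupP; exists n.
Qed.

(** * Finiteness properties of polycyclic groups *)

Definition finitely_generated (G : groupType) (A : subgroup G) : Prop :=
  exists2 s : seq G, (forall x, x \in s -> subgroup_set A x) &
    forall B : subgroup G, (forall x, x \in s -> subgroup_set B x) -> A `<=` B.

(** To generators of [A] inside [N] one adds an element of [A] that generates
    [A] modulo [N]. *)
Lemma polycyclic_finitely_generated (G : groupType) (A : subgroup G) :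
  polycyclic G -> finitely_generated A.
Proof.
move=> polyG; pose P (H : subgroup G) :=
  forall A : subgroup G, A `<=` H -> finitely_generated A.
suff : P (full_subgroup G) by apply.
apply: polycyclic_ind polyG => {A} [A sA1|H N g nNH Hg gen_g fgN A sAH].
  exists [::] => // B _ x /sA1 ->; exact: (is_subgroup1 (subgroupP B)).
have [a Aa gen_a] := cyclic_over_subgroup nNH sAH Hg gen_g.
have [|s sAN gen_s] := fgN (setI_subgroup A N); first by move=> x [].
exists (a :: s) => [x|B sB x Ax]; first by rewrite inE => /predU1P[->|/sAN[]].
have Ba : subgroup_set B a by apply: sB; rewrite mem_head.
have [n Nx] := gen_a x Ax.
rewrite -(mulVKg (zexpg a n) x); apply: is_subgroupM (subgroupP B) _ _ _ _.
  exact: subgroup_zexpg.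
apply: gen_s => [y sy|]; first by apply: sB; rewrite inE sy orbT.
split=> //; apply: is_subgroupM (subgroupP A) _ _ _ Ax.
by apply: is_subgroupV (subgroupP A) _ _; apply: subgroup_zexpg.
Qed.

Lemma common_multiple (X : eqType) (s : seq X) (Q : X -> nat -> Prop) :
    (forall x k l, Q x k -> Q x (k * l)%N) ->
    (forall x, x \in s -> exists2 k, (0 < k)%N & Q x k) ->
  exists2 k, (0 < k)%N & forall x, x \in s -> Q x k.
Proof.
move=> QM; elim: s => [|x s IHs] Qs; first by exists 1%N.
have [|k k_gt0 Qk] := IHs; first by move=> y sy; apply: Qs; rewrite inE sy orbT.
have [l l_gt0 Ql] := Qs x (mem_head _ _).
exists (k * l)%N => [|y]; first by rewrite muln_gt0 k_gt0.
by rewrite inE => /predU1P[->|/Qk/QM//]; rewrite mulnC; apply: QM.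
Qed.

Definition power_dense (G : groupType) (H : set G) : Prop :=
  forall x : G, exists2 k, (0 < k)%N & H (x ^+ k).

(** In an extension [N <= K] generated modulo [N] by [g], with [g ^ d] in [H],
    the products [g ^ r * f] with [r < d] and [f] a representative for [N]
    suffice: the part of [x] that is a power of [g ^ d] is absorbed by [H]. *)
Lemma power_dense_coset_reps (G : groupType) (H : subgroup G) :
    polycyclic G -> power_dense H ->
  exists s : seq G, forall x, exists2 f, f \in s & subgroup_set H (f^-1 * x).
Proof.
move=> polyG denseH.
pose P (K : subgroup G) := exists s : seq G, forall x, subgroup_set K x ->
  exists2 f, f \in s & subgroup_set H (f^-1 * x).
suff [s reps] : P (full_subgroup G) by exists s => x; apply: reps.
apply: polycyclic_ind polyG => [|K N g nNK Kg gen_g [s reps]].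
  exists [:: 1] => _ ->; exists 1; rewrite ?mem_head// mulg1 invg1.
  exact: (is_subgroup1 (subgroupP H)).
have [d d_gt0 Hgd] := denseH g.
exists [seq g ^+ r * f | r <- iota 0 d, f <- s] => x /gen_g[n Nx].
have [q [r lt_rd En]] := int_divn n d_gt0.
(* x = g ^ r * u ^ h^-1 * h, and reps applies to the middle factor *)
pose h := zexpg (g ^+ d) q; pose u := (zexpg g n)^-1 * x.
have Hh : subgroup_set H h by apply: subgroup_zexpg.
have Eg : zexpg g n = g ^+ r * h.
  by rewrite En GRing.addrC zexpgD zexpgM.
have Ku : subgroup_set N (u ^ h^-1).
  case: nNK => _ NJ; apply: NJ => //; apply: (is_subgroupV (subgroupP K)).
  by apply: subgroup_zexpg; apply: (subgroup_zexpg d Kg).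
have [f sf Hf] := reps _ Ku.
exists (g ^+ r * f); first by apply: allpairs_f => //; rewrite mem_iota.
rewrite (_ : (_ * f)^-1 * x = f^-1 * u ^ h^-1 * h).
  exact: is_subgroupM (subgroupP H) _ _ Hf Hh.
by rewrite conjgE invgK /u Eg !invgM !mulgA mulgVK mulgK.
Qed.

Lemma power_dense_finite_index (G : groupType) (H : subgroup G) :
  polycyclic G -> power_dense H -> finite_index H.
Proof.
move=> polyG denseH; have [s reps] := power_dense_coset_reps polyG denseH.
apply: (@sub_finite_set _ _ [set left_coset f H | f in [set` s]]).
  move=> _ [x _ <-]; have [f sf Hfx] := reps x; exists f => //.
  have [_ HM HV] := subgroupP H.
  apply/seteqP; split=> _ [y Hy <-].
    exists ((f^-1 * x)^-1 * y); first by apply: HM => //; apply: HV.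
    by rewrite invgM invgK -mulgA mulVKg.
  exists (f^-1 * x * y); first exact: HM.
  by rewrite -mulgA mulVKg.
by apply: finite_image; apply: finite_seq.
Qed.

Definition torsion (G : groupType) (x : G) : Prop :=
  exists2 k, (0 < k)%N & x ^+ k = 1.

(** In an extension [N <= K] with cyclic quotient: if the quotient has finite
    order dividing [d], the height of [x] is that of [x ^ d] in [N]; if it is
    infinite, it is the absolute value of the image of [x] in the integers when
    this is nonzero, and the height of [x] in [N] otherwise. *)
Lemma polycyclic_height (G : groupType) : polycyclic G ->
  exists2 l : G -> nat, (forall x n, l (zexpg x n) = (`|n| * l x)%N) &
    forall x, l x = 0%N -> torsion x.
Proof.
move=> polyG.
pose P (K : subgroup G) := exists2 l : G -> nat,
    (forall x n, subgroup_set K x -> l (zexpg x n) = (`|n| * l x)%N) &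
    forall x, subgroup_set K x -> l x = 0%N -> torsion x.
suff [l lX l0] : P (full_subgroup G).
  by exists l => [x n|x]; [apply: lX|apply: l0].
apply: polycyclic_ind polyG => [|K N g nNK Kg gen_g [l lX l0]].
  exists (fun=> 0%N) => [x n _|_ -> _]; first by rewrite muln0.
  by exists 1%N.
have [N1 NM NV] := subgroupP N.
have [[d d_gt0 Nd]|infN] := pselect (exists2 d, (0 < d)%N & subgroup_set N (g ^+ d)).
  have NX x : subgroup_set K x -> subgroup_set N (x ^+ d).
    move=> Kx; have [n Nx] := gen_g x Kx.
    have := coset_zexpg nNK d (subgroup_zexpg n Kg) Nx; rewrite -zexpgM.
    rewrite GRing.mulrC zexpgM => /(NM _ _ (subgroup_zexpg n Nd)).
    by rewrite mulVKg.
  exists (fun x => l (x ^+ d)) => [x n /NX/lX <-|x /NX Nx /l0[//|k k_gt0]].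
    by rewrite -[_ ^+ d]/(zexpg _ d) -zexpgM GRing.mulrC zexpgM.
  by exists (d * k)%N; rewrite ?muln_gt0 ?d_gt0// expgnA.
have uniq_n n : subgroup_set N (zexpg g n) -> n = 0%R.
  case: n => [[//|n]|n] /= Ng; case: infN; exists n.+1 => //.
  by rewrite -[_ ^+ _]invgK; apply: NV.
(* e is the quotient map from K to the infinite cyclic group K / N *)
have /choice[e eP] : forall x, exists n : int,
    subgroup_set K x -> subgroup_set N ((zexpg g n)^-1 * x).
  move=> x; have [Kx|nKx] := pselect (subgroup_set K x); last by exists 0%R.
  by have [n Nx] := gen_g x Kx; exists n.
have e_uniq x n : subgroup_set K x -> subgroup_set N ((zexpg g n)^-1 * x) -> e x = n.
  move=> Kx /(coset_sym)Nx; have := coset_trans (eP x Kx) Nx.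
  rewrite -zexpgN -zexpgD => /uniq_n/eqP.
  by rewrite GRing.addrC GRing.subr_eq0 => /eqP.
have eX x n : subgroup_set K x -> e (zexpg x n) = (e x * n)%R.
  move=> Kx; apply: e_uniq; first exact: subgroup_zexpg.
  by rewrite zexpgM; exact: coset_zexpg (subgroup_zexpg _ Kg) (eP x Kx).
have e0 x : subgroup_set K x -> e x = 0%R -> subgroup_set N x.
  by move=> Kx ex0; have := eP x Kx; rewrite ex0 /= invg1 mul1g.
exists (fun x => if e x == 0%R then l x else `|e x|%N) => [x n Kx|x Kx].
  rewrite eX // GRing.mulf_eq0; have [ex0|_ /=] := eqVneq.
    by rewrite lX //; apply: e0.
  have [->|_] := eqVneq; last by rewrite abszM mulnC.
  exact: lX 1 0%R N1.
by case: eqVneq => [/(e0 x Kx)/l0//|/negPf exN0 /eqP]; rewrite absz_eq0 exN0.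
Qed.

(** * Periodic elements of an automorphism *)

Lemma aut_fun_zexpg (G : groupType) (T : automorphism G) x n :
  T (zexpg x n) = zexpg (T x) n.
Proof. by case: n => k /=; rewrite ?aut_funV aut_funX. Qed.

Fact is_subgroup_fix (G : groupType) (T : automorphism G) :
  is_subgroup [set x | T x = x].
Proof.
split=> [|x y /= Tx Ty|x /= Tx]; first exact: aut_fun1.
- by rewrite aut_funM Tx Ty.
- by rewrite aut_funV Tx.
Qed.

Definition fix_subgroup (G : groupType) (T : automorphism G) :=
  Subgroup (is_subgroup_fix T).

Section AutomorphismIterates.
Context (G : groupType) (T : automorphism G).

Fact iter_autM n : {morph iter n T : x y / x * y}.
Proof. by elim: n => // n IHn x y; rewrite !iterS IHn aut_funM. Qed.

Fact iter_autK n : cancel (iter n T) (iter n (aut_inv T)).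
Proof. by elim: n => // n IHn x; rewrite iterSr iterS aut_funK IHn. Qed.

Fact iter_autVK n : cancel (iter n (aut_inv T)) (iter n T).
Proof. by elim: n => // n IHn x; rewrite iterSr iterS aut_invK IHn. Qed.

Definition aut_iter n : automorphism G :=
  Automorphism (@iter_autM n) (@iter_autK n) (@iter_autVK n).

Lemma iter_aut_zexpg k x n : iter k T (zexpg x n) = zexpg (iter k T x) n.
Proof. exact: (aut_fun_zexpg (aut_iter k)). Qed.

Lemma iter_autV n x : iter n T x^-1 = (iter n T x)^-1.
Proof. exact: (aut_funV (aut_iter n)). Qed.

Lemma aut_funJ x y : T (x ^ y) = T x ^ T y.
Proof. by rewrite !conjgE !aut_funM aut_funV. Qed.

Lemma iter_aut_collision x i j :
  (i <= j)%N -> iter i T x = iter j T x -> iter (j - i) T x = x.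
Proof.
by move=> /subnKC{1}<-; rewrite iterD => /(can_inj (@iter_autK i)).
Qed.

Definition periodic (x : G) : Prop := exists2 n, (0 < n)%N & iter n T x = x.

Lemma iter_period n k x : iter n T x = x -> iter (n * k) T x = x.
Proof. by move=> Tx; rewrite mulnC iterM iter_fix. Qed.

Fact is_subgroup_periodic : is_subgroup periodic.
Proof.
split=> [|x y [m m_gt0 Tx] [n n_gt0 Ty]|x [n n_gt0 Tx]].
- by exists 1%N; rewrite //= aut_fun1.
- exists (m * n)%N; first by rewrite muln_gt0 m_gt0.
  by rewrite iter_autM iter_period // mulnC iter_period.
- by exists n; rewrite // iter_autV Tx.
Qed.

Definition periodic_subgroup := Subgroup is_subgroup_periodic.

Lemma periodic_iter k x : periodic (iter k T x) -> periodic x.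
Proof.
move=> [n n_gt0 Tx]; exists n => //; apply: (can_inj (@iter_autK k)).
by rewrite -iterD addnC iterD.
Qed.

(** A common period of finitely many generators of the subgroup of periodic
    elements is a period of all of them. *)
Lemma periodic_uniform : polycyclic G ->
  exists2 n, (0 < n)%N & forall x, periodic x -> iter n T x = x.
Proof.
move=> /(polycyclic_finitely_generated periodic_subgroup)[s sP gen_s].
have [x k l|x /sP//|n n_gt0 fix_s] :=
    @common_multiple _ s (fun x n => iter n T x = x).
  exact: iter_period.
by exists n => // x; exact: (gen_s (fix_subgroup (aut_iter n)) fix_s x).
Qed.

End AutomorphismIterates.

Section Escape.
Context (G : groupType) (T : automorphism G) (polyG : polycyclic G).

Lemma finite_nat_bound (A : set nat) :
  finite_set A -> exists M, forall k, A k -> (k < M)%N.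
Proof.
move=> /finite_seqP[s ->]; exists (\max_(k <- s) k).+1 => k /= sk.
by rewrite ltnS; apply: leq_bigmax_seq.
Qed.

(** Every iterate of a non-torsion [g] has height at least 1, so the height of
    [T ^ k (g ^ n)] is at least [|n|]: membership in [K] bounds [|n|]. *)
Lemma cycle_hits_finite g (K : set G) : finite_set K ->
  finite_set [set y | subgroup_set (cycle_subgroup g) y /\
                      exists k, K (iter k T y)].
Proof.
move=> finK; have [[d d_gt0 gd1]|torN] := pselect (torsion g).
  apply: (@sub_finite_set _ _ [set g ^+ r | r in `I_d]); last first.
    by apply: finite_image; apply: finite_II.
  move=> _ [/cycle_subgroupP[n ->] _]; have [q [r lt_rd ->]] := int_divn n d_gt0.
  have g1 : zexpg 1 q = 1 :> G by case: q => k /=; rewrite expg1n ?invg1.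
  by exists r => //; rewrite zexpgD zexpgM /= gd1 g1 mul1g.
have [l lX l0] := polycyclic_height polyG.
have [M ltM] := finite_nat_bound (finite_image l finK).
apply: (@sub_finite_set _ _ ([set g ^+ i | i in `I_M.+1] `|`
                             [set g ^- i | i in `I_M.+1])); last first.
  by rewrite finite_setU; split; apply: finite_image; apply: finite_II.
move=> _ [/cycle_subgroupP[n ->] [k Kn]].
have lt_nM : (`|n| < M)%N.
  apply: leq_ltn_trans (ltM _ (imageP l Kn)).
  rewrite iter_aut_zexpg lX leq_pmulr // lt0n; apply/eqP.
  move=> /l0[d d_gt0 gd1]; apply: torN; exists d => //.
  apply: (can_inj (@iter_autK _ T k)).
  rewrite [RHS](aut_fun1 (aut_iter T k)) -gd1.
  exact: (aut_funX (aut_iter T k)).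
case: n lt_nM {Kn} => i /= lt_iM; first by left; exists i => //; apply: ltnW.
by right; exists i.+1 => //; apply: ltnW.
Qed.

(** Finitely many elements ever visit [K], and the orbit map of a non-periodic
    one is injective. *)
Lemma cycle_escape g (K : set G) : finite_set K ->
  exists k0, forall k y, (k0 <= k)%N -> subgroup_set (cycle_subgroup g) y ->
    K (iter k T y) -> periodic T y.
Proof.
move=> finK; pose Y := [set y | subgroup_set (cycle_subgroup g) y /\
                                exists k, K (iter k T y)] `\` periodic T.
have finE : finite_set (\bigcup_(y in Y) [set k | K (iter k T y)]).
  apply: bigcup_finite => [|y [_ perN]].
    by apply: finite_setD; apply: cycle_hits_finite.
  apply: (finite_preimage (f := fun k => iter k T y)) finK => i j _ _ eq_ij.
  wlog lt_ij : i j eq_ij / (i < j)%N.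
    by move=> W; have [/W->//|/W->//|//] := ltngtP i j.
  case: perN; exists (j - i)%N; first by rewrite subn_gt0.
  by apply: iter_aut_collision => //; apply: ltnW.
have [k0 ltk0] := finite_nat_bound finE.
exists k0 => k y le_k0k gy Ky; apply: contrapT => perN.
have : (k < k0)%N by apply: ltk0; exists y => //; split=> //; split=> //; exists k.
by rewrite ltnNge le_k0k.
Qed.

End Escape.

(** * Nilpotent normal subgroups are periodic *)

Section CyclicNorm.
Context (G : groupType) (A : subgroup G) (g : G) (m : nat).
Hypothesis A_abelian : @abelian_subgroups G A.
Hypothesis AJ : forall v, subgroup_set A v -> subgroup_set A (v ^ g).
Hypothesis A_gm : forall v, subgroup_set A v -> commute v (g ^+ m).
Hypothesis m_gt0 : (0 < m)%N.
Implicit Types (v w : G) (k : nat).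

(** This is the product of the conjugates of [v] by [g ^ (k - 1), ..., g, 1], in
    this order: in [(g * v) ^ k] the factors [g] are pushed to the left. For
    [k = m] it is the norm of [v] under the action of [g]. *)
Definition partial_norm k v := g ^- k * (g * v) ^+ k.

Lemma partial_normS k v : partial_norm k.+1 v = partial_norm k v ^ g * v.
Proof.
by rewrite /partial_norm conjgE !expgSr invgM !mulgA.
Qed.

Let A1 := is_subgroup1 (subgroupP A).
Let AM := is_subgroupM (subgroupP A).
Let AV := is_subgroupV (subgroupP A).

Lemma partial_norm_in k v : subgroup_set A v -> subgroup_set A (partial_norm k v).
Proof.
move=> Av; elim: k => [|k IHk]; first by rewrite /partial_norm mulVg.
by rewrite partial_normS; apply: AM => //; apply: AJ.
Qed.

Lemma partial_normM k v w : subgroup_set A v -> subgroup_set A w ->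
  partial_norm k (v * w) = partial_norm k v * partial_norm k w.
Proof.
move=> Av Aw; elim: k => [|k IHk]; first by rewrite /partial_norm !mulVg mulg1.
rewrite !partial_normS IHk conjMg -[LHS]mulgA -[RHS]mulgA; congr (_ * _).
rewrite [LHS]mulgA [RHS]mulgA; congr (_ * _).
by apply: A_abelian => //; apply/AJ/partial_norm_in.
Qed.

Lemma partial_normX k v n : subgroup_set A v ->
  partial_norm k (v ^+ n) = partial_norm k v ^+ n.
Proof.
move=> Av; elim: n => [|n IHn].
  by rewrite /partial_norm mulg1 mulVg.
by rewrite !expgS partial_normM ?IHn //; apply: (subgroup_zexpg n Av).
Qed.

Lemma commg_in v : subgroup_set A v -> subgroup_set A [~ v, g].
Proof. by move=> Av; apply: AM; [apply: AV|apply: AJ]. Qed.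

(** The commutator is also [[~ g, v^-1]], as [A] is abelian, so [g * [~ v, g]] is
    the conjugate of [g] by [v^-1]; its [m]-th power is [g ^ m], because [v]
    commutes with [g ^ m]. *)
Lemma norm_commg v : subgroup_set A v -> partial_norm m [~ v, g] = 1.
Proof.
move=> Av; have -> : [~ v, g] = [~ g, v^-1].
  rewrite commgEl commgEr invgK.
  by apply: A_abelian; [apply: AV|apply: AJ].
rewrite /partial_norm commgEl mulVKg -conjXg.
rewrite (_ : _ ^ v^-1 = g ^+ m) ?mulVg //.
by apply/conjg_fixP/commgP/commuteV/commute_sym/A_gm.
Qed.

(** If [[~ v, g] ^ k = 1] then [v ^ k] commutes with [g], so that its norm is
    [v ^ (k m)]; but this norm is the [k]-th power of the trivial norm of [v]. *)
Lemma torsion_commg v : subgroup_set A v -> partial_norm m v = 1 ->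
  torsion [~ v, g] -> torsion v.
Proof.
move=> Av nv1 [k k_gt0 vgk1]; exists (k * m)%N; first by rewrite muln_gt0 k_gt0.
have gvk : commute g (v ^+ k).
  apply: commute_sym; apply/commgP/eqP; rewrite commgEl conjXg -expVgn -expgMn.
    exact: vgk1.
  by apply: A_abelian; [apply: AV|apply: AJ].
have := partial_normX m k Av; rewrite nv1 expg1n /partial_norm expgMn //.
by rewrite mulKg expgnA.
Qed.

(** Descending induction along [v, [~ v, g], [~ v, g, g], ...]: all the terms
    after [v] have trivial norm by [norm_commg], and torsion goes back from each
    term to the previous one by [torsion_commg]. *)
Lemma norm1_unipotent_torsion r v : subgroup_set A v -> partial_norm m v = 1 ->
  iter r (fun w => [~ w, g]) v = 1 -> torsion v.
Proof.
elim: r v => [|r IHr] v Av nv1; first by move=> /= ->; exists 1%N.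
rewrite iterSr => /IHr tor_vg; apply: torsion_commg => //; apply: tor_vg.
  exact: commg_in.
exact: norm_commg.
Qed.

End CyclicNorm.

Section Core.
Context (G : groupType).
Implicit Types H C : subgroup G.

Fact is_subgroup_core (H : subgroup G) :
  is_subgroup [set h | forall x, subgroup_set H (h ^ x)].
Proof.
have [H1 HM HV] := subgroupP H; split=> [x|h k Hh Hk x|h Hh x].
- by rewrite conj1g.
- by rewrite conjMg; apply: HM.
- by rewrite conjVg; apply: HV.
Qed.

Definition core H := Subgroup (is_subgroup_core H).

Lemma coreJ H h x : subgroup_set (core H) h -> subgroup_set (core H) (h ^ x).
Proof. by move=> Hh y; rewrite -conjgM. Qed.

Lemma core_sub H : core H `<=` H.
Proof. by move=> h /(_ 1); rewrite conjg1. Qed.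

(** Only finitely many conjugates of [H] occur, so a common multiple of the
    exponents needed for each of them works. *)
Lemma core_power_dense H : polycyclic G -> power_dense H -> power_dense (core H).
Proof.
move=> polyG denseH h; have [s reps] := power_dense_coset_reps polyG denseH.
have [H1 HM HV] := subgroupP H.
have [f k l|f _|k k_gt0 Hk] :=
  @common_multiple _ s (fun f k => subgroup_set H ((h ^+ k) ^ f)).
- by move=> Hk; rewrite expgnA conjXg; apply: (subgroup_zexpg l Hk).
- by have [k k_gt0] := denseH (h ^ f); exists k; rewrite // conjXg.
exists k => // x; have [f sf Hfx] := reps x.
rewrite -(mulVKg f x) conjgM conjgE; apply: (HM); first exact: HV.
by apply: HM => //; apply: Hk.
Qed.

Fact is_subgroup_center (C : subgroup G) :
  is_subgroup [set v | subgroup_set C v /\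
                       forall h, subgroup_set C h -> commute h v].
Proof.
have [C1 CM CV] := subgroupP C; split=> [|v w [Cv cv] [Cw cw]|v [Cv cv]].
- by split=> // h _; apply: commute1.
- by split=> [|h Ch]; [apply: CM|apply: commuteM; [apply: cv|apply: cw]].
- by split=> [|h Ch]; [apply: CV|apply: commuteV; apply: cv].
Qed.

Definition center C := Subgroup (is_subgroup_center C).

(** The first commutator is in [N] by normality, although [c] need not be; from
    then on one goes down the lower central series. *)
Lemma lower_central_commg (N : subgroup G) g c i :
    normal_in N (full_subgroup G) -> subgroup_set N g ->
  subgroup_set (lower_central N i) (iter i.+1 (fun w => [~ w, g]) c).
Proof.
move=> [_ NJ] Ng; elim: i => [|i IHi].
  have [_ NM NV] := subgroupP N.
  by rewrite /= commgEr; apply: (NM) => //; apply: NJ => //; apply: NV.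
apply: sub_gen_smallest; exists (iter i.+1 (fun w => [~ w, g]) c), g.
by split.
Qed.

Lemma nilpotent_normal_periodic (T : automorphism G) (N : subgroup G) :
    polycyclic G -> normal_in N (full_subgroup G) -> nilpotent_subgroup N ->
  power_dense (periodic T) -> N `<=` periodic T.
Proof.
move=> polyG nN [r Nr1] dense_per g Ng.
have [n n_gt0 fix_per] := periodic_uniform T polyG.
pose C := core (periodic_subgroup T).
have fixC h : subgroup_set C h -> iter n T h = h.
  by move=> /core_sub Ph; apply: fix_per.
have denseC : power_dense C by apply: core_power_dense.
have [s reps] := power_dense_coset_reps polyG denseC.
have [CM CV] := (is_subgroupM (subgroupP C), is_subgroupV (subgroupP C)).
(* two iterates of g under T ^ n lie in the same coset of C *)
have [i [j [lt_ij Cij]]] : exists i j, (i < j)%N /\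
    subgroup_set C ((iter (n * i) T g)^-1 * iter (n * j) T g).
  have /choice[f fP] : forall i, exists f,
      f \in s /\ subgroup_set C (f^-1 * iter (n * i) T g).
    by move=> i; have [f sf Cf] := reps (iter (n * i) T g); exists f.
  have [i [j [lt_ij eq_f]]] : exists i j, (i < j)%N /\ f i = f j.
    apply: contrapT => f_inj; apply: infinite_nat.
    rewrite -(preimage_setT f); apply: (sub_finite_set (B := f @^-1` [set` s])).
      by move=> i _; have [] := fP i.
    apply: finite_preimage (finite_seq s) => i j _ _ eq_f.
    have [lt_ij|lt_ji|//] := ltngtP i j; case: f_inj.
      by exists i, j.
    by exists j, i.
  exists i, j; split=> //; have [_ /CV] := fP i; have [_] := fP j; rewrite -eq_f.
  move=> Cj /CM/(_ Cj); congr (subgroup_set C _).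
  by rewrite invgM invgK -mulgA mulVKg.
pose R := aut_iter T (n * (j - i)); pose c := g^-1 * R g.
have RC h : subgroup_set C h -> R h = h.
  by move=> /fixC Th; rewrite /= iter_period.
have Cc : subgroup_set C c.
  (* an iterate of c is in C, so c is periodic, hence equal to this iterate *)
  have Ec : iter (n * i) T c = (iter (n * i) T g)^-1 * iter (n * j) T g.
    rewrite iter_autM iter_autV /=.
    by rewrite -iterD -mulnDr subnKC // ltnW.
  have /fix_per Tc : periodic T c.
    by apply: (@periodic_iter _ _ (n * i)); rewrite Ec; apply: core_sub Cij.
  by rewrite -(iter_period i Tc) Ec.
have Rg : R g = g * c by rewrite mulVKg.
(* R fixes both h and its conjugate by g^-1, and it maps g to g * c *)
have cC h : subgroup_set C h -> commute h c.
  move=> Ch; have Cgh : subgroup_set C (h ^ g^-1) by apply: coreJ.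
  have := RC _ Cgh; rewrite (aut_funJ R) (aut_funV R) (RC h Ch) Rg.
  rewrite invgM conjgM => /conjg_inj/conjg_fixP/commgP.
  by move=> /commuteV; rewrite invgK.
have [m m_gt0 Cgm] := denseC g.
have [k k_gt0 ck1] : torsion c.
  apply: (@norm1_unipotent_torsion _ (center C) g m _ _ _ m_gt0 r.+1).
  - by move=> v w [Cv _] [_ cw]; apply: cw.
  - move=> v [Cv cv]; split=> [|h Ch]; first exact: coreJ.
    rewrite -(conjgKV g h) /commute -!conjMg cv //; exact: coreJ.
  - by move=> v [_ cv]; apply/commute_sym/cv.
  - by [].
  - by rewrite /partial_norm -Rg -(aut_funX R) RC // mulVg.
  - by have := lower_central_commg c r nN Ng; rewrite Nr1.
exists (n * (j - i) * k)%N; first by rewrite !muln_gt0 n_gt0 subn_gt0 lt_ij.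
have Rk l : iter l R g = g * c ^+ l.
  elim: l => [|l IHl]; first by rewrite mulg1.
  by rewrite iterS IHl aut_funM Rg aut_funX (RC c Cc) -mulgA -expgS.
by rewrite mulnC iterM; have := Rk k; rewrite ck1 mulg1.
Qed.

End Core.

(** * The Chabauty topology *)

Section ChabautyNeighborhoods.
Context (G : groupType).
Implicit Types (A B C : subgroup G) (s : seq G) (U : set (subgroup G)).

Definition agree_on s A B : Prop :=
  forall x, x \in s -> (subgroup_set A x <-> subgroup_set B x).

Definition has_agree_nbhs A U : Prop :=
  exists s, forall B, agree_on s B A -> U B.

Lemma agree_on_cat s1 s2 A B :
  agree_on (s1 ++ s2) A B <-> agree_on s1 A B /\ agree_on s2 A B.
Proof.
split=> [AB|[AB1 AB2] x]; last by rewrite mem_cat => /orP[/AB1|/AB2].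
by split=> x sx; apply: AB; rewrite mem_cat sx ?orbT.
Qed.

Lemma nbhs_agree_on s A : nbhs A [set B | agree_on s B A].
Proof.
elim: s => [|x s IHs]; first by apply: filterS filterT.
have nbhs_x : nbhs A [set B | subgroup_set B x <-> subgroup_set A x].
  have [Ax|nAx] := pselect (subgroup_set A x).
    apply: (@filterS _ _ _ [set B : subgroup G | B `&` [set x] !=set0]).
      by move=> B [y [By /= xy]]; rewrite -xy in Ax *.
    apply: open_nbhs_nbhs; split; last by exists x.
    by apply: chabauty_subbasis_open; right; exists [set x].
  apply: (@filterS _ _ _ [set B : subgroup G | B `&` [set x] = set0]).
    move=> B B0; split=> // Bx; suff : set0 x by [].
    by rewrite -B0.
  apply: open_nbhs_nbhs; split.
    by apply: chabauty_subbasis_open; left; exists [set x]; first exact: finite_set1.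
  by apply/seteqP; split=> // y [Ay /= yx]; apply: nAx; rewrite -yx.
apply: filterS (filterI nbhs_x IHs) => B [Bx Bs] y.
by rewrite inE => /predU1P[->|/Bs].
Qed.

Lemma chabauty_subbasis_agree A V :
  chabauty_subbasis V -> V A -> has_agree_nbhs A V.
Proof.
move=> [[K finK <-]|[U _ <-]] /= VA.
  have /finite_seqP[s Es] := finK; exists s => B AB.
  apply/seteqP; split=> // x [Bx Kx].
  have sx : x \in s by move: Kx; rewrite Es.
  by rewrite -VA; split=> //; apply/AB.
have [x [Ax Ux]] := VA; exists [:: x] => B AB; exists x; split=> //.
by apply/AB => //; rewrite mem_head.
Qed.

(** A finite intersection of subbasic sets is stable under changes of [A] off a
    finite set. Conversely, the membership status of a single [x] is fixed by a
    subbasic set, the one of [U = {x}] or the one of [K = {x}]. *)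
Lemma nbhs_chabautyP A U : nbhs A U <-> has_agree_nbhs A U.
Proof.
split=> [|[s sU]]; last by apply: filterS (nbhs_agree_on s A).
rewrite nbhsE => -[_ [[D' D'sub <-] [i D'i iA]] subU].
have [F sF defi] := D'sub i D'i.
have [s sV] : has_agree_nbhs A (\bigcap_(V in [set` F]) V).
  have FA V : V \in F -> V A by move=> FV; move: iA; rewrite -defi; apply.
  have Fsub V : V \in F -> chabauty_subbasis V by move=> /sF; rewrite inE.
  have hasV V : V \in (F : seq _) -> has_agree_nbhs A V.
    by move=> FV; apply: chabauty_subbasis_agree; [apply: Fsub|apply: FA].
  suff [s sV] : exists s, forall B, agree_on s B A ->
      forall V, V \in (F : seq _) -> V B.
    by exists s => B AB V /= FV; apply: sV.
  elim: (F : seq _) hasV => [|V l IHl] hasV; first by exists [::].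
  have [s1 sV1] := hasV V (mem_head _ _).
  have [|s2 sV2] := IHl; first by move=> W lW; apply: hasV; rewrite inE lW orbT.
  exists (s1 ++ s2) => B /agree_on_cat[/sV1 VB /sV2 lB] W.
  by rewrite inE => /predU1P[->|/lB].
exists s => B /sV sB; apply: subU; exists i => //.
by rewrite -defi.
Qed.

(** Any cyclic subgroup that agrees with [A] on generators of [A] contains
    [A]. *)
Lemma closed_cyclic_subgroups : polycyclic G -> closed (@cyclic_subgroups G).
Proof.
move=> polyG A clA.
have [s sA gen_s] := polycyclic_finitely_generated A polyG.
have [B [cB AB]] := clA _ (nbhs_agree_on s A).
apply: cyclic_subgroup_cyclic cB _; apply: gen_s => x sx.
by apply/AB => //; apply: sA.
Qed.

End ChabautyNeighborhoods.

(** * Distality *)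

Lemma distalP (X : topologicalType) (S : homeomorphism X) :
  distal S <-> forall x y : X, x <> y -> forall z : X, exists2 U : set X, nbhs z U &
    forall n, ~ (U (homeo_iter S n x) /\ U (homeo_iter S n y)).
Proof.
split=> [dS x y /dS cl0 z|dS x y /dS Uxy].
  apply: contrapT => noU; suff : set0 (z, z) by [].
  rewrite -cl0; split=> // V [[V1 V2] /= [V1z V2z] V12].
  apply: contrapT => V0; apply: noU; exists (V1 `&` V2); first exact: filterI.
  move=> n [[V1x _] [_ V2y]]; apply: V0.
  exists (homeo_iter S n x, homeo_iter S n y); split; first by exists n.
  exact: V12.
apply/seteqP; split=> // -[z z'] [clz /= zz']; subst z'.
have [U zU nU] := Uxy z.
have [|_ [[n _ <-] [Ux Uy]]] := clz (U `*` U); first by exists (U, U).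
by apply: (nU n).
Qed.

Lemma nbhs_set_type (X : topologicalType) (A : set X) (a : A) (U : set A) :
  nbhs a U <-> exists2 V, nbhs (\val a) V & forall b : A, V (\val b) -> U b.
Proof.
split=> [|[V aV VU]].
  rewrite nbhsE => -[_ [[V oV <-] aV] VU]; exists V; last exact: VU.
  by exists V; first split.
apply: filterS VU _.
exact: (@initial_continuous A X set_val a V aV).
Qed.

Lemma restrict_homeo_iter (X : topologicalType) (S : homeomorphism X)
    (A : set X) SA SVA n (a : A) :
  \val (homeo_iter (@restrict_homeo X S A SA SVA) n a) = homeo_iter S n (\val a).
Proof.
have iter_val (f : X -> X) fA k (b : A) :
    \val (iter k (@restrict_fun X A f fA) b) = iter k f (\val b).
  by elim: k => //= k ->.
by case: n => k; apply: iter_val.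
Qed.

(** The orbits stay in [A], so it does not matter whether neighborhoods are taken
    in [A] or in [X]. *)
Lemma distal_restrictP (X : topologicalType) (S : homeomorphism X)
    (A : set X) SA SVA :
  distal (@restrict_homeo X S A SA SVA) <->
  forall x y, A x -> A y -> x <> y -> forall z : X, A z ->
    exists2 U : set X, nbhs z U &
    forall n, ~ (U (homeo_iter S n x) /\ U (homeo_iter S n y)).
Proof.
split=> [/distalP dS x y Ax Ay xy z Az|dS].
  pose a x Ax : A := exist _ x (mem_set Ax).
  have [|U /nbhs_set_type[V zV VU] nU] := dS (a x Ax) (a y Ay) _ (a z Az).
    by move=> /(congr1 val).
  by exists V => // n [Vx Vy]; apply: (nU n); split; apply: VU;
    rewrite restrict_homeo_iter.
apply/distalP => x y xy z.
have [|||U zU nU] := dS (\val x) (\val y) _ _ _ (\val z) (set_mem (valP z)).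
- exact: set_mem (valP x).
- exact: set_mem (valP y).
- by move=> /val_inj.
exists (\val @^-1` U); first by apply/nbhs_set_type; exists U.
by move=> n []; rewrite /= !restrict_homeo_iter => Ux Uy; apply: (nU n).
Qed.

Section SubgroupDistality.
Context (G : groupType) (T : automorphism G).
Implicit Types (A B C : subgroup G) (SS : set (subgroup G)) (n : int).

Definition aut_pow n : automorphism G :=
  match n with
  | Posz k => aut_iter T k
  | Negz k => aut_iter (aut_inverse T) k.+1
  end.

Lemma subgroup_image_iter (S : automorphism G) k A :
  iter k (subgroup_image S) A = subgroup_image (aut_iter S k) A.
Proof.
elim: k => [|k IHk]; apply: subgroup_inj; first by rewrite /= image_id.
by rewrite iterS IHk /= image_comp.
Qed.

Lemma homeo_iter_image n A :
  homeo_iter (subgroup_homeo T) n A = subgroup_image (aut_pow n) A.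
Proof. by case: n => k; apply: subgroup_image_iter. Qed.

Lemma subgroup_imageP (S : automorphism G) A x :
  subgroup_set (subgroup_image S A) (S x) <-> subgroup_set A x.
Proof.
split=> [[y Ay /(can_inj (@aut_funK _ S)) <-//]|Ax].
by exists x.
Qed.

Lemma periodic_orbit x : periodic T x ->
  exists s : seq G, forall n, aut_pow n x \in s.
Proof.
move=> [d d_gt0 Tx]; exists [seq iter r T x | r <- iota 0 d] => n.
have [j ->] : exists j, aut_pow n x = iter j T x.
  case: n => k; first by exists k.
  exists (d * k.+1 - k.+1)%N; rewrite -[LHS]/(iter k.+1 (aut_inv T) x).
  rewrite -[in LHS](iter_period k.+1 Tx) -{1}(subnKC (leq_pmull k.+1 d_gt0)).
  by rewrite iterD (iter_autK T k.+1).
rewrite {1}(divn_eq j d) addnC iterD mulnC iter_period //.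
by apply/mapP; exists (j %% d)%N; rewrite // mem_iota ltn_pmod.
Qed.

(** Distality on the invariant subspace [SS], with neighborhoods of a subgroup
    [C] replaced by agreement with [C] on a finite set. Stating it for subsets
    of the whole space makes the monotonicity in [SS] immediate. *)
Definition distal_on SS : Prop := forall A B, SS A -> SS B -> A <> B ->
  forall C, SS C -> exists s, forall n,
    ~ (agree_on s (subgroup_image (aut_pow n) A) C /\
       agree_on s (subgroup_image (aut_pow n) B) C).

Lemma distal_onS SS1 SS2 : SS1 `<=` SS2 -> distal_on SS2 -> distal_on SS1.
Proof.
move=> sSS dSS A B SA SB AB C SC.
exact: dSS (sSS _ SA) (sSS _ SB) AB C (sSS _ SC).
Qed.

Lemma distal_subgroups_on (SS : set (subgroup G)) :
  (forall A B, SS A -> SS B -> A <> B -> forall C, SS C ->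
     exists2 U : set (subgroup G), nbhs C U & forall n,
       ~ (U (homeo_iter (subgroup_homeo T) n A) /\
          U (homeo_iter (subgroup_homeo T) n B))) <-> distal_on SS.
Proof.
split=> dSS A B SA SB AB C SC.
  have [U /nbhs_chabautyP[s sU] nU] := dSS A B SA SB AB C SC.
  exists s => n [/sU An /sU Bn]; apply: (nU n).
  by rewrite !homeo_iter_image.
have [s ns] := dSS A B SA SB AB C SC.
exists [set D | agree_on s D C]; first exact: nbhs_agree_on.
by move=> n; rewrite !homeo_iter_image; apply: ns.
Qed.

Lemma distal_subgroup_homeo : distal (subgroup_homeo T) <-> distal_on setT.
Proof.
split=> [/distalP dT|/distal_subgroups_on dT].
  by apply/distal_subgroups_on => A B _ _ AB C _; apply: dT.
by apply/distalP => A B AB C; apply: dT.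
Qed.

Lemma distal_abelian_homeo :
  distal (abelian_homeo T) <-> distal_on (@abelian_subgroups G).
Proof. by split=> [/distal_restrictP/distal_subgroups_on|dT]; last
  by apply/distal_restrictP/distal_subgroups_on. Qed.

Lemma distal_cyclic_homeo :
  distal (cyclic_homeo T) <-> distal_on (@cyclic_subgroups G).
Proof. by split=> [/distal_restrictP/distal_subgroups_on|dT]; last
  by apply/distal_restrictP/distal_subgroups_on. Qed.

Lemma cyclic_abelian : @cyclic_subgroups G `<=` @abelian_subgroups G.
Proof.
move=> _ [x ->] _ _ /cycle_subgroupP[m ->] /cycle_subgroupP[n ->].
by rewrite /commute -!zexpgD GRing.addrC.
Qed.

Lemma cycle_subgroup1 : cycle_subgroup 1 = one_subgroup G.
Proof.
apply: subgroup_ext => x; split=> [|->]; last exact: cycle_subgroup_id.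
exact: (@cycle_subgroup_sub _ 1 (one_subgroup G)).
Qed.

Lemma cyclic_one : @cyclic_subgroups G (one_subgroup G).
Proof.
by exists 1; rewrite cycle_subgroup1.
Qed.

Lemma subgroup_image_one (S : automorphism G) :
  subgroup_image S (one_subgroup G) = one_subgroup G.
Proof. by apply: subgroup_inj; rewrite /= image_set1 aut_fun1. Qed.

(** A sequence that contracts [A] to the trivial subgroup brings [A] and the
    fixed point [{1}] together. *)
Lemma distal_cyclic_NC : distal_on (@cyclic_subgroups G) -> NC T.
Proof.
move=> dT A cA A1 n cvgA.
have [s ns] := dT _ _ cA cyclic_one A1 _ cyclic_one.
have [N _ /(_ N (leqnn N)) As] := cvgA _ (nbhs_agree_on s (one_subgroup G)).
apply: (ns (n N)); rewrite subgroup_image_one; split=> //.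
by rewrite -homeo_iter_image.
Qed.

(** Take [x] in exactly one of [A] and [B]. If the images of [A] and [B] under
    [T ^ k] both agreed with [C] on the finite orbit of [x], then [T ^ k x] would
    be in both or in none of them. *)
Lemma periodic_distal (n : nat) : (0 < n)%N -> (forall x, iter n T x = x) ->
  distal_on setT.
Proof.
move=> n_gt0 Tn A B _ _ AB C _.
have [x ABx] : exists x, ~ (subgroup_set A x <-> subgroup_set B x).
  by apply: contrapT => nAB; apply: AB; apply: subgroup_ext => x;
    apply: contrapT => ABx; apply: nAB; exists x.
have [|s sx] := @periodic_orbit x; first by exists n.
exists s => k [AC BC]; apply: ABx.
rewrite -(subgroup_imageP (aut_pow k) A) -(subgroup_imageP (aut_pow k) B).
by rewrite (AC _ (sx k)) (BC _ (sx k)).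
Qed.

(** A periodic [y] other than 1 in [A] has a finite orbit, which avoids 1 and
    which all the images of [A] meet. *)
Lemma periodic_elements_NC : (forall x, x <> 1 ->
    exists y, [/\ subgroup_set (cycle_subgroup x) y, y <> 1 & periodic T y]) ->
  NC T.
Proof.
move=> perT A [x Ax] A1 n cvgA.
have [|y [xy y1 pery]] := perT x.
  by move=> x1; apply: A1; rewrite Ax x1 cycle_subgroup1.
have [s sy] := periodic_orbit pery.
have [N _ /(_ N (leqnn N)) As] := cvgA _ (nbhs_agree_on s (one_subgroup G)).
have : aut_pow (n N) y = 1.
  by apply: (As _ (sy (n N))).1; rewrite homeo_iter_image; exists y; rewrite // Ax.
rewrite -(aut_fun1 (aut_pow (n N))) => /(can_inj (@aut_funK _ _))/y1.
by [].
Qed.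

(** Otherwise the elements of the cyclic subgroup other than 1 escape from all
    finite sets, i.e., its images under the powers of [T] tend to [{1}]. *)
Lemma NC_periodic_elements : polycyclic G -> NC T -> forall x, x <> 1 ->
  exists y, [/\ subgroup_set (cycle_subgroup x) y, y <> 1 & periodic T y].
Proof.
move=> polyG ncT x x1; apply: contrapT => noy.
apply: (ncT (cycle_subgroup x) _ _ Posz); first by exists x.
  by move=> x1'; apply: x1; have := cycle_subgroup_id x; rewrite x1'.
move=> U /nbhs_chabautyP[s sU].
have [k0 esc] := cycle_escape T polyG x
  (finite_setD [set 1] (finite_seq s)).
exists k0 => // k /= le_k0k; apply: sU => z sz; rewrite subgroup_image_iter.
split=> [[y xy Ty]|->]; last exact: is_subgroup1 (subgroupP _).
apply: contrapT => z1; apply: noy; exists y; split=> //.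
  by move=> y1; apply: z1; rewrite -Ty y1; apply: (aut_fun1 (aut_iter T k)).
by apply: (esc k) => //=; rewrite [iter k T y]Ty.
Qed.

(** By escape, the images of the cyclic group [A] of [x] come close to the
    subgroup [B] of its periodic elements, and [B] is cyclic and fixed by the
    powers of [T ^ n]. Distality then forces [A = B]. *)
Lemma distal_cyclic_periodic : polycyclic G ->
  distal_on (@cyclic_subgroups G) -> forall x, periodic T x.
Proof.
move=> polyG dT x; apply: contrapT => nPx.
have [n n_gt0 fix_per] := periodic_uniform T polyG.
pose A := cycle_subgroup x; pose B := setI_subgroup A (periodic_subgroup T).
have cA : cyclic_subgroups A by exists x.
have cB : cyclic_subgroups B by apply: cyclic_subgroup_cyclic cA _ => y [].
have AB : A <> B.
  move=> AB; apply: nPx; have : subgroup_set A x by apply: cycle_subgroup_id.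
  by rewrite AB => -[].
have [s ns] := dT A B cA cB AB B cB.
have [k0 esc] := cycle_escape T polyG x (finite_seq s).
pose k := (n * k0)%N.
have fixk y : periodic T y -> iter k T y = y.
  by move=> /fix_per Ty; apply: iter_period.
apply: (ns (Posz k)); split=> z sz; split.
- move=> [y Ay /= Ty].
  have Py : periodic T y by apply: (esc k); rewrite ?leq_pmull//= Ty.
  by rewrite -Ty fixk.
- by move=> [Az Pz]; exists z => //=; apply: fixk.
- by move=> [y [Ay Py] /= <-]; rewrite fixk.
- by move=> [Az Pz]; exists z => //=; apply: fixk.
Qed.

End SubgroupDistality.

(** * The equivalences *)

Theorem theorem4p4 (G : groupType) (T : automorphism G) (Gnil : subgroup G)
    (polyG : polycyclic G) (GnilP : maximal_nilpotent_normal Gnil) :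
  let s1 := NC T in
  let s2 :=
    exists (n : nat) (G' : subgroup G),
      [/\ (0 < n)%N, finite_index G', Gnil `<=` G',
          (forall x, subgroup_set G' x -> iter n T x = x) &
          forall x : G, x <> 1 -> G' `&` cycle_subgroup x <> [set 1]] in
  let s3 := distal (cyclic_homeo T) in
  let s4 := distal (abelian_homeo T) in
  let s5 := distal (subgroup_homeo T) in
  let s6 := exists2 n : nat, (0 < n)%N & forall x : G, iter n T x = x in
  [/\ closed (@cyclic_subgroups G),
      s1 <-> s2,
      [<-> s3; s4; s5; s6] &
      nilpotent_subgroup (full_subgroup G) -> [<-> s1; s2; s3; s4; s5; s6]].
Proof.
move=> s1 s2 s3 s4 s5 s6.
have s12 : s1 -> s2.
  move=> /(NC_periodic_elements polyG) perT.
  have [n n_gt0 fix_per] := periodic_uniform T polyG.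
  have dense_per : power_dense (periodic T).
    move=> x; have [->|/eqP x1] := eqVneq x 1.
      by exists 1%N; last exact: is_subgroup1 (is_subgroup_periodic T).
    have [y [/cycle_subgroupP[m Ey] y1 Py]] := perT x x1.
    case: m Ey => k Ey; last first.
      exists k.+1 => //; rewrite -[x ^+ _]invgK.
      by apply: (is_subgroupV (is_subgroup_periodic T)); rewrite Ey in Py.
    exists k; last by rewrite Ey in Py.
    by case: k Ey => // /y1.
  exists n, (periodic_subgroup T); split=> //.
  - exact: power_dense_finite_index.
  - by case: GnilP => nN nilN _; apply: nilpotent_normal_periodic.
  - move=> x /perT[y [xy y1 Py]] eq1; apply: y1.
    suff : [set 1 : G] y by [].
    by rewrite -eq1; split.
have s21 : s2 -> s1.
  move=> [n [G' [n_gt0 _ _ fixG' meetG']]]; apply: periodic_elements_NC => x x1.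
  apply: contrapT => noy; apply: (meetG' x x1); apply/seteqP; split=> [y [G'y xy]|].
    by apply: contrapT => y1; apply: noy; exists y; split=> //; exists n => //; apply: fixG'.
  by move=> _ ->; split; apply: is_subgroup1 (subgroupP _).
have s36 : s3 -> s6.
  move=> /distal_cyclic_homeo/(distal_cyclic_periodic polyG) perT.
  have [n n_gt0 fix_per] := periodic_uniform T polyG.
  by exists n => // x; apply: fix_per.
have s65 : s6 -> s5.
  by move=> [n n_gt0 Tn]; apply/distal_subgroup_homeo/(periodic_distal n_gt0 Tn).
have s54 : s5 -> s4.
  by move=> /distal_subgroup_homeo/(distal_onS (@subsetT _ _))/distal_abelian_homeo.
have s43 : s4 -> s3.
  by move=> /distal_abelian_homeo/(distal_onS (@cyclic_abelian G))/distal_cyclic_homeo.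
have s31 : s3 -> s1 by move=> /distal_cyclic_homeo/distal_cyclic_NC.
split; [exact: closed_cyclic_subgroups|by split| |move=> nilG].
  by tfae; [move/s36/s65/s54|move/s43/s36/s65|move/s54/s43/s36|move/s65/s54/s43].
(* by maximality Gnil is the whole group, so that G' is also *)
have s26 : s2 -> s6.
  have [_ _ /(_ (full_subgroup G)) maxN] := GnilP.
  move=> [n [G' [n_gt0 _ sNG' fixG' _]]]; exists n => // x; apply/fixG'/sNG'.
  by rewrite -maxN.
tfae; [exact: s12|by move/s26/s65/s54/s43|by move/s36/s65/s54|
       by move/s43/s36/s65|by move/s54/s43/s36|by move/s65/s54/s43/s31].
Qed.
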